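(* Let $(X,d)$ be a metric space, $f:X\to X$ a continuous map and $k\in\mathbb{N}$. (i) $(X,f)$ is strongly $\beta$-$n$-sensitive if and only if $(X,f^k)$ is strongly $\beta$-$n$-sensitive. (ii) For each fixed $n\in\mathbb{N}$ with $n\ge2$, $(X,f)$ is semi-strongly $\beta$-$n$-sensitive if and only if $(X,f^k)$ is semi-strongly $\beta$-$n$-sensitive.
   Context: $\mathbb{N}=\{1,2,3,\dots\}$; $f^k$ is the $k$-fold composition. For a continuous map $g:X\to X$, $n\ge2$ and $\beta=(m_1,\dots,m_n)\in\mathbb{N}^n$, $(X,g)$ is $\beta$-$n$-sensitive if there is $\delta>0$ such that for every nonempty open $U\subseteq X$ there are $q\in\mathbb{N}$ and $x_1,\dots,x_n\in U$ with $\min_{1\leq i<j\leq n}d(g^{m_iq}(x_i),g^{m_jq}(x_j))>\delta$. - $(X,g)$ is semi-strongly $\beta$-$n$-sensitive (for a fixed $n\geq 2$) if it is $\beta$-$n$-sensitive for every $\beta\in\mathbb{N}^n$. - $(X,g)$ is strongly $\beta$-$n$-sensitive if it is $\beta$-$n$-sensitive for every $n\geq2$ and every $\beta\in\mathbb{N}^n$. *)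

(* Defs.v *)
From HB Require Import structures.
From mathcomp Require Import all_boot all_order all_algebra.
From mathcomp Require Import all_classical all_reals all_analysis.

Set Implicit Arguments.
Unset Strict Implicit.
Unset Printing Implicit Defensive.

Import Order.TTheory GRing.Theory Num.Theory.
Local Open Scope classical_set_scope.
Local Open Scope ring_scope.

(* The set of natural numbers of the text starts at 1; over [nat] this becomes
   explicit positivity of the exponents, of the time [q] and of [k]. *)
Definition pos_exponents (n : nat) (m : 'I_n -> nat) : Prop :=
  forall i : 'I_n, (0 < m i)%N.

(* The minimum is computed in the extended reals, where +oo is the neutral
   element; for 2 <= n the index set is nonempty, so it is the minimum of a
   finite nonempty set of real distances. *)
Definition min_pairwise_dist (R : realType) (X : metricType R) (n : nat)
    (y : 'I_n -> X) : \bar R :=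
  \big[Order.min/+oo%E]_(p : 'I_n * 'I_n | (p.1 < p.2)%N)
    (mdist (y p.1) (y p.2))%:E.

Definition beta_sensitive (R : realType) (X : metricType R) (g : X -> X)
    (n : nat) (m : 'I_n -> nat) : Prop :=
  exists2 delta : R, 0 < delta &
    forall U : set X, open U -> U !=set0 ->
      exists q : nat, exists x : 'I_n -> X,
        [/\ (0 < q)%N, (forall i, U (x i)) &
            (delta%:E < min_pairwise_dist (fun i => iter (m i * q) g (x i)))%E].

Definition semi_strongly_sensitive (R : realType) (X : metricType R)
    (g : X -> X) (n : nat) : Prop :=
  forall m : 'I_n -> nat, pos_exponents m -> beta_sensitive g m.

Definition strongly_sensitive (R : realType) (X : metricType R)
    (g : X -> X) : Prop :=
  forall n : nat, (2 <= n)%N ->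
  forall m : 'I_n -> nat, pos_exponents m -> beta_sensitive g m.

(* Main.v *)
(* Since (f^k)^(m_i q) = f^((m_i k) q) = f^(m_i (q k)), the factor k can be
   absorbed either into the exponents or into the time: f^k is beta-sensitive
   as soon as f is (k beta)-sensitive, and f is beta-sensitive as soon as f^k
   is, with the same delta and the same points. *)
Require Import Defs.
From HB Require Import structures.
From mathcomp Require Import all_boot all_order all_algebra.
From mathcomp Require Import all_classical all_reals all_analysis.
Local Open Scope classical_set_scope.
Local Open Scope ring_scope.

Section SensitivityOfIterates.
Context {R : realType} {X : metricType R}.
Implicit Types (f : X -> X) (n k : nat).

Lemma beta_sensitive_iter f n k (m : 'I_n -> nat) :
  beta_sensitive f (fun i => m i * k)%N -> beta_sensitive (iter k f) m.
Proof.
move=> [delta delta_gt0 sens]; exists delta => // U oU U0.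
have [q [x [q_gt0 Ux far]]] := sens U oU U0; exists q, x; split=> //.
by under [X in min_pairwise_dist X]funext => i do rewrite -iterM mulnAC.
Qed.

Lemma iter_beta_sensitive f n k (m : 'I_n -> nat) : (0 < k)%N ->
  beta_sensitive (iter k f) m -> beta_sensitive f m.
Proof.
move=> k_gt0 [delta delta_gt0 sens]; exists delta => // U oU U0.
(* The exponents [m] stay fixed, so the time absorbs [k]; [0 < k] keeps [q * k] positive. *)
have [q [x [q_gt0 Ux far]]] := sens U oU U0; exists (q * k)%N, x.
split; [by rewrite muln_gt0 q_gt0 | by [] |].
by under [X in min_pairwise_dist X]funext => i do rewrite mulnA iterM.
Qed.

(** Quantifying over all positive exponents makes the class stable under [m i] to [m i * k], which
    the forward direction needs; the number of points [n] never changes. *)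
Lemma semi_strongly_sensitive_iter f n k : (0 < k)%N ->
  semi_strongly_sensitive f n <-> semi_strongly_sensitive (iter k f) n.
Proof.
move=> k_gt0; split=> sens m m_gt0.
  by apply/beta_sensitive_iter/sens => i; rewrite muln_gt0 m_gt0.
exact/(iter_beta_sensitive f n k m k_gt0)/sens.
Qed.

End SensitivityOfIterates.

Theorem theorem12 (R : realType) (X : metricType R) (f : X -> X)
    (f_cont : continuous f) (k : nat) (k_gt0 : (0 < k)%N) :
  (strongly_sensitive f <-> strongly_sensitive (iter k f)) /\
  (forall n : nat, (2 <= n)%N ->
     (semi_strongly_sensitive f n <-> semi_strongly_sensitive (iter k f) n)).
Proof.
split=> [|n _]; last exact: semi_strongly_sensitive_iter.
have sensE n := semi_strongly_sensitive_iter f n k k_gt0.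
(* Strong sensitivity is semi-strong sensitivity for every [n >= 2]. *)
by split=> sens n n_ge2; [apply: (sensE n).1 | apply: (sensE n).2]; exact: sens.
Qed.
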